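(* For every rigid partition $\lambda$ in the $D_n$ theory, the new definition of the symbol of $\lambda$ is equivalent to the old definition: the two procedures produce the same symbol (the same top row and the same bottom row).
   Context: A partition in the $D_n$ theory is a partition $\lambda=(\lambda_1\ge\cdots\ge\lambda_l\ge1)$ of $2n$ in which every even integer occurs an even number of times. It is rigid if it has no gaps ($\lambda_i-\lambda_{i+1}\le1$ for all $i$, with $\lambda_{l+1}=0$) and no odd integer occurs exactly twice. For a sequence $\mu=(\mu_1\ge\cdots\ge\mu_L\ge0)$, form the numbers $L-k+\mu_k$ ($1\le k\le L$), list the odd ones increasingly as $2f_1+1<2f_2+1<\cdots$ and the even ones increasingly as $2g_1<2g_2<\cdots$, and set $A_i=f_i-i+1$, $B_i=g_i-i+1$. A symbol is a two-row array with top row $(\alpha_1,\alpha_2,\dots)$ and bottom row $(\beta_1,\beta_2,\dots)$. The ''$B_n$ procedure'' applied to $\mu$ puts $\alpha_i=A_i$, $\beta_i=B_i$. Old definition ($D_n$): take $\mu=\lambda$, put $\alpha_i=B_i=g_i-i+1$ and $\beta_i=A_i=f_i-i+1$; then $\beta_1=0$ (as $\lambda$ is rigid), and this entry is omitted from the bottom row and the remaining entries are relabelled. New definition ($D_n$): apply the $B_n$ procedure to $\mu=(\lambda,0)$ ($\lambda$ with an extra part $0$ appended), and then delete the first two entries of the bottom row, which are both $0$. *)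

(* Defs.v *)
(* MathComp. Rows and partitions are sequences indexed from 0, so the k-th
   term in 1-based notation is the term of index k - 1. *)
From mathcomp Require Import all_boot all_order all_algebra.
From mathcomp Require Import zify.

Set Implicit Arguments.
Unset Strict Implicit.
Unset Printing Implicit Defensive.

Record Dn_partition (n : nat) (lam : seq nat) : Prop := DnPartition {
  Dn_nonincreasing : sorted geq lam;
  Dn_positive : all (leq 1) lam;
  Dn_sum : sumn lam = 2 * n;
  Dn_even_mult : forall k, ~~ odd k -> ~~ odd (count_mem k lam)
}.

(* The default value 0 of [nth] plays the role of lambda_{l+1} = 0. *)
Record rigid (lam : seq nat) : Prop := Rigid {
  rigid_no_gap : forall i, i < size lam -> nth 0 lam i <= (nth 0 lam i.+1).+1;
  rigid_odd_mult : forall k, odd k -> count_mem k lam != 2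
}.

(* The numbers L - k + mu_k; the subtraction never truncates as k < L. *)
Definition shifted_parts (mu : seq nat) : seq nat :=
  mkseq (fun k => size mu - k.+1 + nth 0 mu k) (size mu).

Definition f_seq (mu : seq nat) : seq nat :=
  [seq x./2 | x <- sort leq [seq x <- shifted_parts mu | odd x]].

Definition g_seq (mu : seq nat) : seq nat :=
  [seq x./2 | x <- sort leq [seq x <- shifted_parts mu | ~~ odd x]].

(* From s_1, s_2, ... to the sequence of the integers s_i - i + 1. *)
Definition subtract_rank (s : seq nat) : seq int :=
  mkseq (fun i => (nth 0 s i)%:Z - i%:Z)%R (size s).

Definition A_seq (mu : seq nat) : seq int := subtract_rank (f_seq mu).
Definition B_seq (mu : seq nat) : seq int := subtract_rank (g_seq mu).

Record symbol : Type := Symbol { top_row : seq int; bottom_row : seq int }.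

Definition Bn_procedure (mu : seq nat) : symbol :=
  Symbol (A_seq mu) (B_seq mu).

Definition Dn_symbol_old (lam : seq nat) : symbol :=
  Symbol (B_seq lam) (behead (A_seq lam)).

Definition Dn_symbol_new (lam : seq nat) : symbol :=
  let s := Bn_procedure (rcons lam 0) in
  Symbol (top_row s) (drop 2 (bottom_row s)).

(* For n > 0 the entries removed by [behead] and [drop 2] above exist and
   vanish; for n = 0 (the empty partition) both symbols have empty rows. *)

Lemma mem_shifted_parts (mu : seq nat) k : k < size mu ->
  size mu - k.+1 + nth 0 mu k \in shifted_parts mu.
Proof. by move=> lk; apply: map_f; rewrite mem_iota. Qed.

Lemma shifted_parts_uniq (mu : seq nat) :
  sorted geq mu -> uniq (shifted_parts mu).
Proof.
move=> smu; rewrite map_inj_in_uniq ?iota_uniq // => i j.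
rewrite !mem_iota /= !add0n => li lj.
have mono a b : a <= b -> b < size mu -> nth 0 mu b <= nth 0 mu a.
  move=> ab lb; have gt : transitive geq by move=> x y z /= h1 h2; lia.
  have gr : reflexive geq by move=> x /=.
  by apply: (sorted_leq_nth gt gr 0 smu) => //; rewrite inE; lia.
by case: (ltngtP i j) => // h; [have := mono i j | have := mono j i]; lia.
Qed.

Lemma last_part (n : nat) (lam : seq nat) :
  Dn_partition n lam -> rigid lam -> 0 < n ->
  0 < size lam /\ nth 0 lam (size lam).-1 = 1.
Proof.
case=> _ pos sm _ [gap _] n0.
have s0 : 0 < size lam by case: lam {pos gap} sm => //=; lia.
split=> //; have l1 : (size lam).-1 < size lam by lia.
have := gap _ l1; rewrite prednK // (nth_default _ (leqnn _)).
have /= := allP pos _ (mem_nth 0 l1).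
by case: (nth 0 lam _) => [|[|x]].
Qed.

Lemma Dn_symbol_old_deleted (n : nat) (lam : seq nat) :
  Dn_partition n lam -> rigid lam -> 0 < n -> take 1 (A_seq lam) = [:: 0%R].
Proof.
move=> Dl rl n0; have [s0 l1] := last_part Dl rl n0.
have m1 : 1 \in sort leq [seq x <- shifted_parts lam | odd x].
  rewrite mem_sort mem_filter /=.
  by have := @mem_shifted_parts lam (size lam).-1; rewrite l1 prednK // subnn; apply.
have := sort_sorted leq_total [seq x <- shifted_parts lam | odd x].
have : all odd (sort leq [seq x <- shifted_parts lam | odd x]).
  by rewrite all_sort filter_all.
rewrite /A_seq /f_seq; case: (sort _ _) m1 => // x s m1 /= /andP[ox _] px.
have : x <= 1.
  move: m1 (order_path_min leq_trans px); rewrite inE => /orP[/eqP<- //|m1].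
  by move/allP/(_ _ m1).
by case: x ox {m1 px} => [|[|x]] // _ _; rewrite /subtract_rank /= take0.
Qed.

Lemma Dn_symbol_new_deleted (n : nat) (lam : seq nat) :
  Dn_partition n lam -> rigid lam -> 0 < n ->
  take 2 (bottom_row (Bn_procedure (rcons lam 0))) = [:: 0%R; 0%R].
Proof.
move=> Dl rl n0; have [s0 l1] := last_part Dl rl n0.
set mu := rcons lam 0; set e := sort leq [seq x <- shifted_parts mu | ~~ odd x].
have smu : sorted geq mu.
  have gt : transitive geq by move=> x y z /= h1 h2; lia.
  rewrite /mu; have := Dn_nonincreasing Dl; case: (lam) => //= x s.
  by rewrite rcons_path => -> /=.
have szmu : size mu = (size lam).+1 by rewrite size_rcons.
have m0 : 0 \in e.
  rewrite mem_sort mem_filter /=; have := @mem_shifted_parts mu (size lam).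
  by rewrite szmu subnn nth_rcons ltnn eqxx; apply.
have m2 : 2 \in e.
  rewrite mem_sort mem_filter /=; have := @mem_shifted_parts mu (size lam).-1.
  by rewrite szmu prednK // nth_rcons prednK // leqnn l1 subSnn addn1; apply; lia.
have ev : all (fun x => ~~ odd x) e by rewrite all_sort filter_all.
have lt : sorted ltn e.
  rewrite ltn_sorted_uniq_leq sort_uniq filter_uniq ?shifted_parts_uniq //=.
  exact: sort_sorted leq_total _.
rewrite /= /B_seq /g_seq -/e; case: e m0 m2 ev lt => // x [|y s].
  by rewrite !inE => /eqP<-.
move=> m0 m2 /= /and3P[ex ey _] /andP[xy py].
have ys : forall z, z \in s -> y < z by apply/allP/(order_path_min ltn_trans).
have x0 : x = 0.
  by move: m0; rewrite !inE => /or3P[/eqP<-|/eqP y0|/ys] //; lia.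
have y2 : y <= 2.
  by move: m2; rewrite !inE => /or3P[/eqP x2|/eqP<-|/ys] //; lia.
have -> : y = 2 by case: y ey y2 xy {m0 m2 py ys} => [|[|[|y]]] //; lia.
by rewrite x0 /subtract_rank /= take0.
Qed.

(* Main.v *)
(** Appending a part 0 to [lam] raises every number [L - k + lam_k] by one and
    adds the number 0. Raising by one swaps parities, so the odd numbers of
    [rcons lam 0] have the halves of the even numbers of [lam], while its even
    numbers are 0 followed by the successors of the odd numbers of [lam]. Their
    halves are 0 followed by the [f_i + 1], and the increase by one cancels the
    shift in rank: the new bottom row is 0 followed by the old one. *)
Require Import Defs.
From mathcomp Require Import all_boot all_order all_algebra.
From mathcomp Require Import zify.

Lemma shifted_parts_rcons0 (mu : seq nat) :
  shifted_parts (rcons mu 0) = rcons (map S (shifted_parts mu)) 0.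
Proof.
rewrite /shifted_parts size_rcons mkseqS nth_rcons ltnn eqxx subnn.
congr rcons; rewrite -map_comp; apply/eq_in_map => k.
by rewrite mem_iota nth_rcons /= => lt_k; rewrite lt_k; lia.
Qed.

Lemma sort_rcons0 (s : seq nat) : sort leq (rcons s 0) = 0 :: sort leq s.
Proof.
apply: (sorted_eq leq_trans anti_leq); first exact: sort_sorted leq_total _.
  rewrite /= path_min_sorted; last exact/allP.
  exact: sort_sorted leq_total _.
by rewrite perm_sort perm_rcons perm_cons perm_sym perm_sort.
Qed.

Lemma f_seq_rcons0 (mu : seq nat) : f_seq (rcons mu 0) = g_seq mu.
Proof.
rewrite /f_seq /g_seq shifted_parts_rcons0 filter_rcons filter_map.
(* [leq] and [odd] pulled back along [S] are convertible to [leq] and [~~ odd], so only the halves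
   remain to be compared. *)
rewrite sort_map -map_comp.
have even_half x : x \in sort leq [seq y <- shifted_parts mu | ~~ odd y] ->
    x.+1./2 = x./2.
  by rewrite mem_sort mem_filter => /andP[ev _]; lia.
exact/eq_in_map.
Qed.

Lemma g_seq_rcons0 (mu : seq nat) :
  g_seq (rcons mu 0) = 0 :: map S (f_seq mu).
Proof.
rewrite /f_seq /g_seq shifted_parts_rcons0 filter_rcons /= sort_rcons0.
rewrite filter_map sort_map /= -!map_comp; congr cons.
under eq_filter => x do rewrite /= negbK.
apply/eq_in_map => x; rewrite mem_sort mem_filter /= => /andP[od _]; lia.
Qed.

Lemma subtract_rank_cons0_succn (s : seq nat) :
  subtract_rank (0 :: map S s) = 0%R :: subtract_rank s.
Proof.
rewrite /subtract_rank [size _]/= size_map /mkseq -add1n iotaD map_cat.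
rewrite (iotaDl 1 0) -map_comp; congr cons; apply/eq_in_map => i.
(* The bound on [i] matters: past the end [nth] returns 0, not a successor. *)
rewrite mem_iota /= => lt_i; rewrite (nth_map 0%R) //.
have succB (a b : nat) : (a.+1%:Z - b.+1%:Z = a%:Z - b%:Z)%R by lia.
exact: succB.
Qed.

Theorem proposition3 (n : nat) (lam : seq nat)
    (hD : Dn_partition n lam) (hrigid : rigid lam) :
  Dn_symbol_new lam = Dn_symbol_old lam.
Proof.
rewrite /Dn_symbol_new /Dn_symbol_old /= /A_seq /B_seq f_seq_rcons0.
(* One of the two deletions removes the new leading 0; the other is the [behead] of the old
   definition. *)
by rewrite g_seq_rcons0 subtract_rank_cons0_succn /= drop1.
Qed.
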